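(* Let $A\in\mathbb{Q}_{\mathbb{R}}^{m\times n}$, $B\in\mathbb{Q}_{\mathbb{R}}^{m\times d}$, $C\in\mathbb{Q}_{\mathbb{R}}^{p\times n}$, $D\in\mathbb{Q}_{\mathbb{R}}^{p\times d}$, with $m\ge n+d$ and $C^R_c$ of full row rank. Put $\hat{P}=[A^R_c,B^R_c]\in\mathbb{R}^{4m\times(n+d)}$ and $\hat{S}=[C^R_c,D^R_c]\in\mathbb{R}^{4p\times(n+d)}$. Consider the QR factorization $$\hat{S}^T=\hat{Q}\begin{bmatrix}\hat{R}\\0\end{bmatrix},\qquad \hat{Q}=[\hat{Q}_1,\hat{Q}_2],\ \hat{Q}_1\in\mathbb{R}^{(n+d)\times 4p},\ \hat{Q}_2\in\mathbb{R}^{(n+d)\times(n+d-4p)},$$ with $\hat Q$ orthogonal. Let the thin SVD of $\hat{P}\hat{Q}_2$ be $\hat{P}\hat{Q}_2=\hat{U}\hat{\Sigma}\hat{V}^T$, where $\hat{U}\in\mathbb{R}^{4m\times(n-4p+d)}$ and $\hat{V}\in\mathbb{R}^{(n-4p+d)\times(n-4p+d)}$ have orthonormal columns and $\hat{\Sigma}=\mathrm{diag}(\hat{\sigma}_1,\ldots,\hat{\sigma}_{n-4p+d})$ with $$\hat{\sigma}_1\ge\cdots\ge\hat{\sigma}_{n-4p}>\hat{\sigma}_{n-4p+1}\ge\cdots\ge\hat{\sigma}_{n-4p+d}>0.$$ Partition $\hat{U}=[\hat{U}_1,\hat{U}_2]$ and $\hat{V}=[\hat{V}_1,\hat{V}_2]$,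 where $\hat U_1,\hat V_1$ have $n-4p$ columns and $\hat U_2,\hat V_2$ have $d$ columns, and $\hat{\Sigma}=\mathrm{diag}(\hat{\Sigma}_1,\hat{\Sigma}_2)$ with $\hat{\Sigma}_1=\mathrm{diag}(\hat\sigma_1,\ldots,\hat\sigma_{n-4p})$, $\hat{\Sigma}_2=\mathrm{diag}(\hat\sigma_{n-4p+1},\ldots,\hat\sigma_{n-4p+d})$. Define $$\check{V}=\hat{Q}_2\hat{V}=[\check{V}_1,\check{V}_2]=\begin{bmatrix}\check{V}_{11}&\check{V}_{12}\\ \check{V}_{21}&\check{V}_{22}\end{bmatrix},$$ with row blocks of sizes $n,d$ and column blocks of sizes $n-4p,d$. If $\hat{\sigma}_{n-4p}>\hat{\sigma}_{n-4p+1}$ and $\check{V}_{22}$ is invertible, then a unique real RBTLSE solution $X\in\mathbb{R}^{n\times d}$ for $(A,B,C,D)$ exists, and it is $$X=-\check{V}_{12}\check{V}_{22}^{-1}.$$ The corresponding minimizing perturbations $\bar{E}=E_0+E_1\mathbf{i}+E_2\mathbf{j}+E_3\mathbf{k}$ and $\bar{F}=F_0+F_1\mathbf{i}+F_2\mathbf{j}+F_3\mathbf{k}$ are given by $$[E_0^T,E_1^T,E_2^T,E_3^T]^T=-\hat{U}_2\hat{\Sigma}_2\check{V}_{12}^T,\qquad [F_0^T,F_1^T,F_2^T,F_3^T]^T=-\hat{U}_2\hat{\Sigma}_2\check{V}_{22}^T.$$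
   Context: $\mathbb{Q}_{\mathbb{R}}$ denotes the reduced biquaternions: the commutative real algebra with basis $1,\mathbf{i},\mathbf{j},\mathbf{k}$ and $\mathbf{j}^2=1$, $\mathbf{i}^2=\mathbf{k}^2=-1$, $\mathbf{i}\mathbf{j}=\mathbf{j}\mathbf{i}=\mathbf{k}$, $\mathbf{j}\mathbf{k}=\mathbf{k}\mathbf{j}=\mathbf{i}$, $\mathbf{k}\mathbf{i}=\mathbf{i}\mathbf{k}=-\mathbf{j}$. For $\alpha=\alpha_0+\alpha_1\mathbf{i}+\alpha_2\mathbf{j}+\alpha_3\mathbf{k}$ ($\alpha_t\in\mathbb{R}$), $\|\alpha\|=\sqrt{\alpha_0^2+\alpha_1^2+\alpha_2^2+\alpha_3^2}$; for $P=(p_{ij})\in\mathbb{Q}_{\mathbb{R}}^{m\times n}$, $\|P\|_F=\sqrt{\sum_{i,j}\|p_{ij}\|^2}$. Real matrices are regarded as reduced biquaternion matrices. For $P=P_0+P_1\mathbf{i}+P_2\mathbf{j}+P_3\mathbf{k}\in\mathbb{Q}_{\mathbb{R}}^{m\times n}$ with $P_t\in\mathbb{R}^{m\times n}$, put $P^R_c=[P_0^T,P_1^T,P_2^T,P_3^T]^T\in\mathbb{R}^{4m\times n}$. Real RBTLSE solution for $(A,B,C,D)$: consider the problem $$\min_{X,\bar{E},\bar{F}}\|[\bar{E},\bar{F}]\|_F\quad\text{subject to}\quad (A+\bar{E})X=B+\bar{F},\quad CX=D,$$ over $X\in\mathbb{R}^{n\times d}$, $\bar{E}\in\mathbb{Q}_{\mathbb{R}}^{m\times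 n}$, $\bar{F}\in\mathbb{Q}_{\mathbb{R}}^{m\times d}$. A real matrix $X$ that satisfies the constraints together with perturbations $\bar E,\bar F$ attaining the minimum is a real RBTLSE solution, and such $\bar{E},\bar{F}$ are corresponding minimizing perturbations. *)

(* Defs.v *)
From HB Require Import structures.
From mathcomp Require Import all_boot all_order all_algebra.
From mathcomp Require Import ring.

Set Implicit Arguments.
Unset Strict Implicit.
Unset Printing Implicit Defensive.

Import Order.TTheory GRing.Theory Num.Theory.
Local Open Scope ring_scope.

(* [RBQ a b c e] is the reduced biquaternion a + b i + c j + e k. *)
Record rbq (R : Type) := RBQ { rb0 : R; rb1 : R; rb2 : R; rb3 : R }.

Section Structures.
Variable R : rcfType.
Local Notation Q := (rbq R).
Implicit Types x y z : Q.

Definition rbq_tuple x := (rb0 x, rb1 x, rb2 x, rb3 x).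
Definition tuple_rbq (t : R * R * R * R) : Q :=
  let: (a, b, c, e) := t in RBQ a b c e.
Lemma rbq_tupleK : cancel rbq_tuple tuple_rbq.
Proof. by case. Qed.

HB.instance Definition _ := Choice.copy Q (can_type rbq_tupleK).

Definition rbq_add x y : Q :=
  RBQ (rb0 x + rb0 y) (rb1 x + rb1 y) (rb2 x + rb2 y) (rb3 x + rb3 y).
Definition rbq_opp x : Q := RBQ (- rb0 x) (- rb1 x) (- rb2 x) (- rb3 x).

Definition rbq_mul x y : Q :=
  RBQ
    (rb0 x * rb0 y - rb1 x * rb1 y + rb2 x * rb2 y - rb3 x * rb3 y)
    (rb0 x * rb1 y + rb1 x * rb0 y + rb2 x * rb3 y + rb3 x * rb2 y)
    (rb0 x * rb2 y + rb2 x * rb0 y - rb1 x * rb3 y - rb3 x * rb1 y)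
    (rb0 x * rb3 y + rb3 x * rb0 y + rb1 x * rb2 y + rb2 x * rb1 y).

Definition rbq_scale (a : R) x : Q :=
  RBQ (a * rb0 x) (a * rb1 x) (a * rb2 x) (a * rb3 x).

Lemma rbq_addA : associative rbq_add.
Proof. by move=> x y z; congr RBQ => /=; ring. Qed.
Lemma rbq_addC : commutative rbq_add.
Proof. by move=> x y; congr RBQ => /=; ring. Qed.
Lemma rbq_add0 : left_id (RBQ 0 0 0 0) rbq_add.
Proof. by case=> a b c e; congr RBQ => /=; ring. Qed.
Lemma rbq_addN : left_inverse (RBQ 0 0 0 0) rbq_opp rbq_add.
Proof. by move=> x; congr RBQ => /=; ring. Qed.

HB.instance Definition _ :=
  GRing.isZmodule.Build Q rbq_addA rbq_addC rbq_add0 rbq_addN.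

Lemma rbq_mulA : associative rbq_mul.
Proof. by move=> x y z; congr RBQ => /=; ring. Qed.
Lemma rbq_mulC : commutative rbq_mul.
Proof. by move=> x y; congr RBQ => /=; ring. Qed.
Lemma rbq_mul1 : left_id (RBQ 1 0 0 0) rbq_mul.
Proof. by case=> a b c e; congr RBQ => /=; ring. Qed.
Lemma rbq_mulDl : left_distributive rbq_mul (@GRing.add Q).
Proof. by move=> x y z; congr RBQ => /=; ring. Qed.
Lemma rbq_oner_neq0 : RBQ 1 0 0 0 != 0 :> Q.
Proof. by apply/eqP => -[/eqP]; rewrite oner_eq0. Qed.

HB.instance Definition _ :=
  GRing.Zmodule_isComNzRing.Build Q
    rbq_mulA rbq_mulC rbq_mul1 rbq_mulDl rbq_oner_neq0.

Lemma rbq_scaleA a b x : rbq_scale a (rbq_scale b x) = rbq_scale (a * b) x.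
Proof. by congr RBQ => /=; ring. Qed.
Lemma rbq_scale1 : left_id 1 rbq_scale.
Proof. by case=> a b c e; congr RBQ => /=; ring. Qed.
Lemma rbq_scaleDr : right_distributive rbq_scale +%R.
Proof. by move=> a x y; congr RBQ => /=; ring. Qed.
Lemma rbq_scaleDl x : {morph rbq_scale^~ x : a b / a + b}.
Proof. by move=> a b; congr RBQ => /=; ring. Qed.

HB.instance Definition _ :=
  GRing.Zmodule_isLmodule.Build R Q
    rbq_scaleA rbq_scale1 rbq_scaleDr rbq_scaleDl.

Lemma rbq_scaleAl (a : R) x y : a *: (x * y) = (a *: x) * y.
Proof. by congr RBQ => /=; ring. Qed.

HB.instance Definition _ :=
  GRing.Lmodule_isLalgebra.Build R Q rbq_scaleAl.
HB.instance Definition _ := GRing.Lalgebra_isComAlgebra.Build R Q.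

Definition rbi : Q := RBQ 0 1 0 0.
Definition rbj : Q := RBQ 0 0 1 0.
Definition rbk : Q := RBQ 0 0 0 1.

Lemma rbq_basisE x :
  x = (rb0 x)%:A + rb1 x *: rbi + rb2 x *: rbj + rb3 x *: rbk.
Proof. by case: x => a b c e; congr RBQ => /=; ring. Qed.
Lemma rbii : rbi * rbi = -1. Proof. by congr RBQ => /=; ring. Qed.
Lemma rbjj : rbj * rbj = 1. Proof. by congr RBQ => /=; ring. Qed.
Lemma rbkk : rbk * rbk = -1. Proof. by congr RBQ => /=; ring. Qed.
Lemma rbij : rbi * rbj = rbk. Proof. by congr RBQ => /=; ring. Qed.
Lemma rbjk : rbj * rbk = rbi. Proof. by congr RBQ => /=; ring. Qed.
Lemma rbki : rbk * rbi = - rbj. Proof. by congr RBQ => /=; ring. Qed.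

Definition rb_norm x : R :=
  Num.sqrt (rb0 x ^+ 2 + rb1 x ^+ 2 + rb2 x ^+ 2 + rb3 x ^+ 2).

Definition rb_frob m n (P : 'M[Q]_(m, n)) : R :=
  Num.sqrt (\sum_i \sum_j rb_norm (P i j) ^+ 2).

Definition rb_of_real_mx m n (X : 'M[R]_(m, n)) : 'M[Q]_(m, n) :=
  map_mx (in_alg Q) X.

End Structures.

(* Equal to 4 * m, in the form in which [col_mx] builds the number of rows. *)
Notation fourfold m := (m + (m + (m + m)))%N.

Lemma fourfoldE m : fourfold m = (4 * m)%N.
Proof. by rewrite !mulSn mul0n addn0. Qed.

(* P^R_c = [P_0^T, P_1^T, P_2^T, P_3^T]^T *)
Definition rb_col (R : rcfType) m n (P : 'M[rbq R]_(m, n)) :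
    'M[R]_(fourfold m, n) :=
  col_mx (map_mx (@rb0 R) P)
    (col_mx (map_mx (@rb1 R) P)
      (col_mx (map_mx (@rb2 R) P) (map_mx (@rb3 R) P))).

Section RBTLSE.
Variables (R : rcfType) (m n d p : nat).
Variables (A : 'M[rbq R]_(m, n)) (B : 'M[rbq R]_(m, d)).
Variables (C : 'M[rbq R]_(p, n)) (D : 'M[rbq R]_(p, d)).

Definition rbtlse_feasible (X : 'M[R]_(n, d))
    (E : 'M[rbq R]_(m, n)) (F : 'M[rbq R]_(m, d)) : Prop :=
  (A + E) *m rb_of_real_mx X = B + F /\ C *m rb_of_real_mx X = D.

(* E and F are minimizing perturbations corresponding to X; the minimum is
   over all feasible triples, not only those with the given X. *)
Definition rbtlse_minimizer (X : 'M[R]_(n, d))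
    (E : 'M[rbq R]_(m, n)) (F : 'M[rbq R]_(m, d)) : Prop :=
  rbtlse_feasible X E F /\
  forall X' E' F', rbtlse_feasible X' E' F' ->
    rb_frob (row_mx E F) <= rb_frob (row_mx E' F').

Definition real_rbtlse_solution (X : 'M[R]_(n, d)) : Prop :=
  exists E F, rbtlse_minimizer X E F.

End RBTLSE.

(* Main.v *)
Require Import Defs.
From HB Require Import structures.
From mathcomp Require Import all_boot all_order all_algebra.
From mathcomp Require Import reals.
From mathcomp Require Import ring lra.

Set Implicit Arguments.
Unset Strict Implicit.
Unset Printing Implicit Defensive.

Import Order.TTheory GRing.Theory Num.Theory.
Local Open Scope ring_scope.

(* Stacking the four real components of a reduced biquaternion matrix is an
   injective isometry for the Frobenius norm that commutes with right
   multiplication by real matrices. So the problem is real: minimize ||G|| subject to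
   (P + G) Z = 0 and S Z = 0, with Z = [X; -I]. Since R^ is invertible, S Z = 0
   means Z = Q2 W, and H = G Q2 must satisfy (P Q2 + H) W = 0. With Pi the
   orthogonal projector onto the range of W, of rank d, this gives
   ||H||^2 >= ||P Q2 Pi||^2 = tr (Sigma^2 V^T Pi V), at least the sum of the d
   smallest sigma_i^2. By the gap, equality forces Pi = V2 V2^T, hence
   determines Z, X and G. *)

(** * Squared Frobenius norm and orthogonal projectors *)

Section SquaredFrobenius.
Variable R : rcfType.

Definition sqf m n (M : 'M[R]_(m, n)) : R := \tr (M *m M^T).

Lemma sqfE m n (M : 'M[R]_(m, n)) : sqf M = \sum_i \sum_j M i j ^+ 2.
Proof.
apply: eq_bigr => i _; rewrite mxE; apply: eq_bigr => j _.
by rewrite mxE expr2.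
Qed.

Lemma sqf_ge0 m n (M : 'M[R]_(m, n)) : 0 <= sqf M.
Proof. by rewrite sqfE; do 2!apply: sumr_ge0 => ? _; apply: sqr_ge0. Qed.

Lemma sqf_eq0 m n (M : 'M[R]_(m, n)) : sqf M = 0 -> M = 0.
Proof.
rewrite sqfE => /eqP; rewrite psumr_eq0 => [/allP h|i _]; last first.
  by apply: sumr_ge0 => ? _; apply: sqr_ge0.
apply/matrixP => i j; have := h i (mem_index_enum _).
rewrite psumr_eq0 => [/allP h'|? _]; last exact: sqr_ge0.
by have := h' j (mem_index_enum _); rewrite /= sqrf_eq0 mxE => /eqP.
Qed.

Lemma sqfD_orth m n (A B : 'M[R]_(m, n)) :
  A *m B^T = 0 -> sqf (A + B) = sqf A + sqf B.
Proof.
move=> AB; have BA : B *m A^T = 0 by rewrite -[B]trmxK -trmx_mul AB trmx0.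
by rewrite /sqf linearD /= mulmxDl !mulmxDr AB BA addr0 add0r mxtraceD.
Qed.

Lemma sqf_opp m n (A : 'M[R]_(m, n)) : sqf (- A) = sqf A.
Proof. by rewrite /sqf linearN /= mulmxN mulNmx opprK. Qed.

Lemma sqf_mul_isom m n q (A : 'M[R]_(m, n)) (B : 'M[R]_(n, q)) :
  B *m B^T = 1%:M -> sqf (A *m B) = sqf A.
Proof. by move=> BB; rewrite /sqf trmx_mul mulmxA -(mulmxA A) BB mulmx1. Qed.

Lemma sqf_isom_mul m n q (A : 'M[R]_(q, m)) (B : 'M[R]_(m, n)) :
  A^T *m A = 1%:M -> sqf (A *m B) = sqf B.
Proof.
by move=> AA; rewrite /sqf trmx_mul mulmxA mxtrace_mulC !mulmxA AA mul1mx.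
Qed.

(** The hypothesis says that [[Q1, Q2]] has orthonormal rows, so right multiplication by it
    preserves the norm. *)
Lemma sqf_split m n q1 q2 (G : 'M[R]_(m, n)) (Q1 : 'M_(n, q1)) (Q2 : 'M_(n, q2)) :
  Q1 *m Q1^T + Q2 *m Q2^T = 1%:M -> sqf G = sqf (G *m Q1) + sqf (G *m Q2).
Proof.
move=> QQ; rewrite /sqf -mxtraceD !trmx_mul !mulmxA -mulmxDl -!(mulmxA G).
by rewrite -mulmxDr QQ mulmx1.
Qed.

(** The left inverse [L] stands for full column rank. If [u *m W^T *m W = 0], then [u *m W^T] has
    norm zero, and [L^T] cancels [W^T]. *)
Lemma gram_unit n d (L : 'M[R]_(d, n)) (W : 'M_(n, d)) :
  L *m W = 1%:M -> W^T *m W \in unitmx.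
Proof.
move=> LW; rewrite -row_free_unit -kermx_eq0; set u := kermx _.
have h : u *m W^T = 0.
  apply: sqf_eq0; rewrite /sqf trmx_mul trmxK mulmxA -(mulmxA u) mulmx_ker.
  by rewrite mul0mx mxtrace0.
have WL : W^T *m L^T = 1%:M by rewrite -trmx_mul LW trmx1.
by rewrite -[u]mulmx1 -WL mulmxA h mul0mx.
Qed.

(** Since [T = T *m T^T], each diagonal entry is the squared norm of its row; so it is nonnegative,
    and the row vanishes with it. *)
Lemma proj_diag n (T : 'M[R]_n) i :
  T^T = T -> T *m T = T -> T i i = \sum_j T i j ^+ 2.
Proof.
move=> Ts TT; rewrite -{1}TT mxE; apply: eq_bigr => j _.
by rewrite -{2}Ts mxE expr2.
Qed.

Lemma proj_diag_ge0 n (T : 'M[R]_n) i : T^T = T -> T *m T = T -> 0 <= T i i.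
Proof.
move=> Ts TT; rewrite proj_diag //.
by apply: sumr_ge0 => ? _; apply: sqr_ge0.
Qed.

(** The complement [1%:M - T] is an orthogonal projector too. *)
Lemma proj_diag_le1 n (T : 'M[R]_n) i : T^T = T -> T *m T = T -> T i i <= 1.
Proof.
move=> Ts TT; have := @proj_diag_ge0 _ (1%:M - T) i.
rewrite !mxE eqxx subr_ge0; apply; first by rewrite linearB /= trmx1 Ts.
by rewrite mulmxBl !mulmxBr !mulmx1 !mul1mx TT subrr subr0.
Qed.

Lemma proj_diag_eq0 n (T : 'M[R]_n) i j :
  T^T = T -> T *m T = T -> T i i = 0 -> T i j = 0.
Proof.
move=> Ts TT; rewrite proj_diag // => /eqP.
rewrite psumr_eq0 => [/allP h|? _]; last exact: sqr_ge0.
by have := h j (mem_index_enum _); rewrite /= sqrf_eq0 => /eqP.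
Qed.

(* With [t := T i i], the trace condition turns the difference of the two sides
   into [\sum_(i < k) (w_i - tau) t_i + \sum_(j < d) (tau - w_(k+j)) (1 - t_(k+j))],
   all of whose terms are nonnegative. *)
Lemma weighted_proj_trace k d (w : 'rV[R]_(k + d)) (tau : R) (T : 'M_(k + d)) :
  (forall i, tau < w 0 (lshift d i)) -> (forall j, w 0 (rshift k j) <= tau) ->
  T^T = T -> T *m T = T -> \tr T = d%:R ->
  \sum_j w 0 (rshift k j) <= \tr (diag_mx w *m T) /\
  (\tr (diag_mx w *m T) = \sum_j w 0 (rshift k j) -> usubmx T = 0).
Proof.
move=> hl hr Ts TT trT.
pose a i := (w 0 (lshift d i) - tau) * T (lshift d i) (lshift d i).
pose b j := (tau - w 0 (rshift k j)) * (1 - T (rshift k j) (rshift k j)).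
have a0 i : 0 <= a i.
  by apply: mulr_ge0; [rewrite subr_ge0 ltW | apply: proj_diag_ge0].
have b0 j : 0 <= b j.
  by apply: mulr_ge0; rewrite subr_ge0 //; apply: proj_diag_le1.
have E : \tr (diag_mx w *m T) =
    \sum_j w 0 (rshift k j) + (\sum_i a i + \sum_j b j).
  have Ea : \sum_i a i = \sum_i w 0 (lshift d i) * T (lshift d i) (lshift d i)
      - tau * \sum_i T (lshift d i) (lshift d i).
    by rewrite mulr_sumr -sumrB; apply: eq_bigr => i _; rewrite -mulrBl.
  have Eb : \sum_j b j = \sum_j w 0 (rshift k j) * T (rshift k j) (rshift k j)
      - \sum_j w 0 (rshift k j) + tau * d%:R
      - tau * \sum_j T (rshift k j) (rshift k j).
    rewrite mulr_natr -[in tau *+ d](card_ord d) -sumr_const mulr_sumr.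
    by rewrite -!sumrB -big_split -sumrB /=; apply: eq_bigr => j _; rewrite /b; ring.
  have Ew : \tr (diag_mx w *m T) =
      \sum_i w 0 (lshift d i) * T (lshift d i) (lshift d i)
      + \sum_j w 0 (rshift k j) * T (rshift k j) (rshift k j).
    rewrite /mxtrace big_split_ord /=.
    by congr (_ + _); apply: eq_bigr => i _; rewrite mul_diag_mx mxE.
  by rewrite Ew Ea Eb -trT /mxtrace big_split_ord /=; ring.
split; first by rewrite E lerDl addr_ge0 // sumr_ge0.
rewrite E => /eqP; rewrite -subr_eq0 addrC addKr paddr_eq0 ?sumr_ge0 //.
case/andP=> h _; move: h; rewrite psumr_eq0 // => /allP h.
apply/matrixP => i j; rewrite !mxE; apply: proj_diag_eq0 => //.
have /= := h i (mem_index_enum _).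
by rewrite mulf_eq0 subr_eq0 gt_eqF ?hl //= => /eqP.
Qed.

End SquaredFrobenius.

(** * Smallest perturbation that makes a matrix kill [d] independent directions *)

Section Perturbation.
Variable R : rcfType.

Lemma sqf_diag n (v : 'rV[R]_n) : sqf (diag_mx v) = \sum_i v 0 i ^+ 2.
Proof.
rewrite /sqf tr_diag_mx mulmx_diag mxtrace_diag.
by apply: eq_bigr => i _; rewrite mxE expr2.
Qed.

Lemma mulmx_split_diag l k d q (U : 'M[R]_(l, k + d)) (s : 'rV_(k + d))
    (T : 'M_(k + d, q)) :
  U *m diag_mx s *m T = lsubmx U *m diag_mx (lsubmx s) *m usubmx T
                      + rsubmx U *m diag_mx (rsubmx s) *m dsubmx T.
Proof.
rewrite -{1}[U]hsubmxK -{1}[s]hsubmxK -{1}[T]vsubmxK diag_mx_row mul_row_block.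
by rewrite !mulmx0 addr0 add0r mul_row_col.
Qed.

Lemma rsubmx_isom l k d (U : 'M[R]_(l, k + d)) :
  U^T *m U = 1%:M -> (rsubmx U)^T *m rsubmx U = 1%:M.
Proof.
rewrite -{1 2}[U]hsubmxK tr_row_mx mul_col_row (scalar_mx_block _ _ 1).
by case/eq_block_mx.
Qed.

(** The projector is [W (W^T W)^-1 W^T]. Together, [Pi *m W = W] and [Pi = W *m J] fix its range and
    yield idempotence. *)
Lemma range_projector n d (L : 'M[R]_(d, n)) (W : 'M_(n, d)) :
  L *m W = 1%:M ->
  exists2 Pi : 'M[R]_n, Pi^T = Pi /\ Pi *m W = W &
    \tr Pi = d%:R /\ exists J, Pi = W *m J.
Proof.
move=> /gram_unit WWu.
exists (W *m invmx (W^T *m W) *m W^T); split.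
- by rewrite !trmx_mul trmx_inv trmx_mul !trmxK !mulmxA.
- by rewrite -!mulmxA mulVmx // mulmx1.
- by rewrite mxtrace_mulC mulmxA mulmxV // mxtrace1.
- by exists (invmx (W^T *m W) *m W^T); rewrite mulmxA.
Qed.

(* [Pi] is the orthogonal projector onto the range of [W]: the constraint
   prescribes [H *m Pi], so that [H] costs at least the part of the singular
   values seen by [Pi]. *)
Lemma min_perturbation l k d (U : 'M[R]_(l, k + d)) (s : 'rV_(k + d))
    (V : 'M_(k + d)) (H : 'M_(l, k + d)) (W : 'M_(k + d, d)) (L : 'M_(d, k + d))
    (tau : R) :
  U^T *m U = 1%:M -> V^T *m V = 1%:M ->
  (forall i, tau < s 0 (lshift d i) ^+ 2) ->
  (forall j, s 0 (rshift k j) ^+ 2 <= tau) ->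
  L *m W = 1%:M -> (U *m diag_mx s *m V^T + H) *m W = 0 ->
  sqf (diag_mx (rsubmx s)) <= sqf H /\
  (sqf H = sqf (diag_mx (rsubmx s)) ->
     (exists K, W = rsubmx V *m K) /\
     H = - (rsubmx U *m diag_mx (rsubmx s) *m (rsubmx V)^T)).
Proof.
move=> UU VV hl hr LW HW; have VV' := mulmx1C VV.
have [Pi [Pis PiW] [trPi [J PiJ]]] := range_projector LW.
have PiPi : Pi *m Pi = Pi by rewrite {2}PiJ mulmxA PiW -PiJ.
have HPi : H *m Pi = - (U *m diag_mx s *m (V^T *m Pi)).
  apply/eqP; rewrite -addr_eq0 addrC mulmxA -mulmxDl PiJ !mulmxA HW.
  by rewrite !mul0mx.
(* [T] is [Pi] in the basis of right singular vectors, so its diagonal weighs the squared singular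
   values. *)
pose T := V^T *m Pi *m V.
have Ts : T^T = T by rewrite /T !trmx_mul Pis trmxK !mulmxA.
have TT : T *m T = T.
  by rewrite /T !mulmxA -(mulmxA _ V) VV' mulmx1 -(mulmxA V^T) PiPi.
have trT : \tr T = d%:R by rewrite /T mxtrace_mulC mulmxA VV' mul1mx.
pose w : 'rV[R]_(k + d) := \row_i s 0 i ^+ 2.
have Ew : sqf (diag_mx (rsubmx s)) = \sum_j w 0 (rshift k j).
  by rewrite sqf_diag; apply: eq_bigr => j _; rewrite !mxE.
(* Pythagoras: [H *m Pi], prescribed by the constraint, contributes the weighted trace. *)
have EH : sqf H = \tr (diag_mx w *m T) + sqf (H - H *m Pi).
  have {1}-> : H = H *m Pi + (H - H *m Pi) by rewrite addrC subrK.
  rewrite sqfD_orth; last first.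
    rewrite linearB /= trmx_mul Pis mulmxBr !mulmxA -[_ *m Pi *m Pi]mulmxA PiPi.
    by rewrite subrr.
  rewrite HPi sqf_opp -mulmxA sqf_isom_mul //; congr (_ + _).
  rewrite /sqf !trmx_mul tr_diag_mx trmxK Pis !mulmxA mxtrace_mulC !mulmxA.
  rewrite mulmx_diag -[_ *m Pi *m Pi]mulmxA PiPi.
  by congr (\tr (diag_mx _ *m _ *m _ *m _)); apply/rowP => i; rewrite !mxE expr2.
have [] := @weighted_proj_trace R k d w tau T _ _ Ts TT trT.
- by move=> i; rewrite mxE.
- by move=> j; rewrite mxE.
rewrite -Ew => h1 h2; split; first by rewrite EH ler_wpDr ?sqf_ge0.
move=> e; have h3 := sqf_ge0 (H - H *m Pi).
(* In the equality case both nonnegative excesses vanish: that of the weighted trace and the part of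
   [H] off [Pi]. *)
have h4 : sqf (H - H *m Pi) = 0 by lra.
have /h2 T0 : \tr (diag_mx w *m T) = sqf (diag_mx (rsubmx s)) by lra.
(* The range of [W] is orthogonal to the leading right singular vectors, hence spanned by the
   trailing ones. *)
have VPi : (lsubmx V)^T *m Pi = 0.
  have -> : (lsubmx V)^T *m Pi = usubmx T *m V^T.
    by rewrite mul_usub_mx /T -mulmxA VV' mulmx1 -mul_usub_mx trmx_lsub.
  by rewrite T0 mul0mx.
have WK : W = rsubmx V *m ((rsubmx V)^T *m W).
  rewrite mulmxA -[LHS]mul1mx -VV' -{1 2}[V]hsubmxK tr_row_mx mul_row_col.
  by rewrite mulmxDl -!mulmxA -{1}PiW (mulmxA _ Pi) VPi mul0mx mulmx0 add0r.
split; first by exists ((rsubmx V)^T *m W).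
(* These square matrices have product [L *m W = 1%:M]; so [W] and [rsubmx V] have the same range,
   and [Pi] fixes [rsubmx V]. *)
have [_ Ku] : L *m rsubmx V \in unitmx /\ (rsubmx V)^T *m W \in unitmx.
  by apply: mulmx1_unit; rewrite -mulmxA -WK.
have VPi2 : Pi *m rsubmx V = rsubmx V.
  by rewrite -[rsubmx V](mulmxK Ku) -WK mulmxA PiW.
move/sqf_eq0/eqP: h4; rewrite subr_eq0 => /eqP ->.
rewrite HPi mulmx_split_diag -!mul_usub_mx -!mul_dsub_mx -trmx_lsub -trmx_rsub.
rewrite VPi mulmx0 add0r; congr (- (_ *m _)).
by rewrite -Pis -trmx_mul VPi2.
Qed.

(** [Q1^T *m Z = 0] puts [Z] in the range of [Q2], which reduces the claim to [H = G *m Q2] and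
    [W = Q2^T *m Z]. The part [G *m Q1] only adds to the cost and vanishes at the minimum. *)
Lemma min_constrained_perturbation l n q k d (P : 'M[R]_(l, n))
    (Q1 : 'M_(n, q)) (Q2 : 'M_(n, k + d)) (U : 'M_(l, k + d)) (s : 'rV_(k + d))
    (V : 'M_(k + d)) (G : 'M_(l, n)) (Z : 'M_(n, d)) (L : 'M_(d, n)) (tau : R) :
  Q2^T *m Q2 = 1%:M -> Q1 *m Q1^T + Q2 *m Q2^T = 1%:M ->
  P *m Q2 = U *m diag_mx s *m V^T ->
  U^T *m U = 1%:M -> V^T *m V = 1%:M ->
  (forall i, tau < s 0 (lshift d i) ^+ 2) ->
  (forall j, s 0 (rshift k j) ^+ 2 <= tau) ->
  L *m Z = 1%:M -> Q1^T *m Z = 0 -> (P + G) *m Z = 0 ->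
  sqf (diag_mx (rsubmx s)) <= sqf G /\
  (sqf G = sqf (diag_mx (rsubmx s)) ->
     (exists K, Z = rsubmx (Q2 *m V) *m K) /\
     G = - (rsubmx U *m diag_mx (rsubmx s) *m (rsubmx (Q2 *m V))^T)).
Proof.
move=> QQ QQ' PQ UU VV hl hr LZ QZ GZ.
have ZW : Z = Q2 *m (Q2^T *m Z).
  by rewrite -[LHS]mul1mx -QQ' mulmxDl -!mulmxA QZ mulmx0 add0r.
have LW : (L *m Q2) *m (Q2^T *m Z) = 1%:M by rewrite -mulmxA -ZW.
have HW : (U *m diag_mx s *m V^T + G *m Q2) *m (Q2^T *m Z) = 0.
  by rewrite -PQ -mulmxDl -mulmxA -ZW.
have [h1 h2] := min_perturbation UU VV hl hr LW HW.
rewrite (sqf_split G QQ'); split; first by rewrite ler_wpDl ?sqf_ge0.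
move=> e; have h3 := sqf_ge0 (G *m Q1).
have /sqf_eq0 G1 : sqf (G *m Q1) = 0 by lra.
have [|[K WK] HE] := h2; first by lra.
rewrite -mulmx_rsub; split; first by exists K; rewrite -mulmxA -WK.
rewrite -[LHS]mulmx1 -QQ' mulmxDr !mulmxA G1 mul0mx add0r HE.
by rewrite mulNmx -!mulmxA trmx_mul.
Qed.

End Perturbation.

(** Take for [tau] the square of the first trailing entry, or 0 when [d = 0]. Squaring keeps the
    order of positive entries. *)
Lemma separating_square (R : rcfType) k d (s : 'rV[R]_(k + d)) :
  (forall i, 0 < s 0 i) ->
  (forall i j : 'I_(k + d), (i <= j)%N -> s 0 j <= s 0 i) ->
  (forall i j : 'I_(k + d), i.+1 = k -> j = k :> nat -> s 0 j < s 0 i) ->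
  exists2 tau, (forall i, tau < s 0 (lshift d i) ^+ 2) &
               (forall j, s 0 (rshift k j) ^+ 2 <= tau).
Proof.
case: d s => [|d] s s0 smono sgap.
  by exists 0 => [i|[]//]; rewrite exprn_gt0.
exists (s 0 (rshift k ord0) ^+ 2) => [i|j]; last first.
  by rewrite ler_sqr ?nnegrE ?(ltW (s0 _)) // smono //= leq_add2l.
rewrite ltr_sqr ?nnegrE ?(ltW (s0 _)) //.
have k0 : (0 < k)%N by case: (k) i => [[]|].
(* The gap only compares positions [k.-1] and [k]; monotonicity carries it to every leading
   index. *)
have lt_k : (k.-1 < k)%N by rewrite prednK.
apply: (@lt_le_trans _ _ (s 0 (lshift d.+1 (Ordinal lt_k)))).
  by apply: sgap; rewrite /= ?prednK ?addn0.
by apply: smono; rewrite /= -ltnS prednK.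
Qed.

(** * Real representation of the reduced biquaternion problem *)

Section RealRepresentation.
Variable R : rcfType.

Lemma rb_colD m n (P P' : 'M[rbq R]_(m, n)) :
  rb_col (P + P') = rb_col P + rb_col P'.
Proof.
rewrite /rb_col !add_col_mx.
by congr (col_mx _ (col_mx _ (col_mx _ _))); apply/matrixP => i j; rewrite !mxE.
Qed.

Lemma rb_col_mul_real m n q (P : 'M[rbq R]_(m, n)) (X : 'M[R]_(n, q)) :
  rb_col (P *m rb_of_real_mx X) = rb_col P *m X.
Proof.
have comp (f : rbq R -> R) : f 0 = 0 -> {morph f : x y / x + y} ->
    (forall x a, f (x * a%:A) = f x * a) ->
    map_mx f (P *m rb_of_real_mx X) = map_mx f P *m X.
  move=> f0 fD fM; apply/matrixP => i j; rewrite !mxE (big_morph f fD f0).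
  by apply: eq_bigr => h _; rewrite !mxE fM.
rewrite /rb_col !mul_col_mx.
by congr (col_mx _ (col_mx _ (col_mx _ _))); apply: comp => // x a /=; ring.
Qed.

Lemma rb_col_inj m n : injective (@rb_col R m n).
Proof.
move=> P P' /eq_col_mx[/matrixP h0 /eq_col_mx[/matrixP h1]].
move=> /eq_col_mx[/matrixP h2 /matrixP h3]; apply/matrixP => i j.
move: (h0 i j) (h1 i j) (h2 i j) (h3 i j); rewrite !mxE.
by case: (P i j) (P' i j) => a b c e [a' b' c' e'] /= -> -> -> ->.
Qed.

(** Lifts the optimal real perturbation back to reduced biquaternions. *)
Lemma rb_col_surj m n (M : 'M[R]_(fourfold m, n)) : exists P, rb_col P = M.
Proof.
pose M1 := dsubmx M; pose M2 := dsubmx M1.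
exists (\matrix_(i, j) RBQ (usubmx M i j) (usubmx M1 i j)
                          (usubmx M2 i j) (dsubmx M2 i j)).
rewrite -[RHS]vsubmxK -[dsubmx M]vsubmxK -[dsubmx (dsubmx M)]vsubmxK.
by congr (col_mx _ (col_mx _ (col_mx _ _))); apply/matrixP => i j; rewrite !mxE.
Qed.

Lemma rb_col_row_mx m n d (E : 'M[rbq R]_(m, n)) (F : 'M[rbq R]_(m, d)) :
  rb_col (row_mx E F) = row_mx (rb_col E) (rb_col F).
Proof.
rewrite /rb_col !map_row_mx; do 3!rewrite -block_mxEh block_mxEv.
by [].
Qed.

Lemma rb_frobE m n (P : 'M[rbq R]_(m, n)) :
  rb_frob P = Num.sqrt (sqf (rb_col P)).
Proof.
congr Num.sqrt; rewrite sqfE !big_split_ord /= -!big_split /=.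
apply: eq_bigr => i _; rewrite -!big_split /=; apply: eq_bigr => j _.
rewrite sqr_sqrtr ?addr_ge0 ?sqr_ge0 //.
by rewrite !(col_mxEu, col_mxEd) !mxE !addrA.
Qed.

(** Multiplying by [[X; -I]] makes both equations homogeneous; the way back uses injectivity of
    [rb_col]. *)
Lemma rbtlse_feasibleE m n d p (A : 'M[rbq R]_(m, n)) (B : 'M_(m, d))
    (C : 'M_(p, n)) (D : 'M_(p, d)) (X : 'M[R]_(n, d)) E F :
  rbtlse_feasible A B C D X E F <->
  (row_mx (rb_col A) (rb_col B) + rb_col (row_mx E F)) *m col_mx X (- 1%:M) = 0 /\
  row_mx (rb_col C) (rb_col D) *m col_mx X (- 1%:M) = 0.
Proof.
rewrite rb_col_row_mx add_row_mx !mul_row_col !mulmxN !mulmx1.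
rewrite -!rb_colD -!rb_col_mul_real; split=> [[-> ->]|[]].
  by rewrite !subrr.
by move=> /subr0_eq/rb_col_inj ? /subr0_eq/rb_col_inj.
Qed.

End RealRepresentation.

(** * Existence, uniqueness and the minimizing perturbations *)

Theorem theorem3p2 (R : realType) (m n d p : nat)
    (A : 'M[rbq R]_(m, n)) (B : 'M[rbq R]_(m, d))
    (C : 'M[rbq R]_(p, n)) (D : 'M[rbq R]_(p, d))
    (hm : (n + d <= m)%N)
    (hC : row_free (rb_col C))
    (* QR factorization of S^T, where S = [C^R_c, D^R_c] *)
    (Q1 : 'M[R]_(n + d, fourfold p))
    (Q2 : 'M[R]_(n + d, (n - fourfold p) + d))
    (Rh : 'M[R]_(fourfold p))
    (hQ : (row_mx Q1 Q2)^T *m row_mx Q1 Q2 = 1%:M)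
    (hQ' : row_mx Q1 Q2 *m (row_mx Q1 Q2)^T = 1%:M)
    (hRh : is_trig_mx Rh^T)
    (hQR : (row_mx (rb_col C) (rb_col D))^T
             = row_mx Q1 Q2 *m col_mx Rh (0 : 'M[R]_((n - fourfold p) + d, fourfold p)))
    (* thin SVD of P Q2, where P = [A^R_c, B^R_c] *)
    (U : 'M[R]_(fourfold m, (n - fourfold p) + d))
    (s : 'rV[R]_((n - fourfold p) + d))
    (V : 'M[R]_((n - fourfold p) + d))
    (hU : U^T *m U = 1%:M)
    (hV : V^T *m V = 1%:M)
    (hSVD : row_mx (rb_col A) (rb_col B) *m Q2 = U *m diag_mx s *m V^T)
    (hs_anti : forall i j : 'I_((n - fourfold p) + d), (i <= j)%N -> s 0 j <= s 0 i)
    (hs_pos : forall i : 'I_((n - fourfold p) + d), 0 < s 0 i)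
    (* indices are 0-based: these are sigma_(n-4p) and sigma_(n-4p+1) *)
    (hs_gap : forall i j : 'I_((n - fourfold p) + d),
        i.+1 = (n - fourfold p)%N -> j = (n - fourfold p)%N :> nat -> s 0 j < s 0 i) :
  let U2 : 'M[R]_(fourfold m, d) := rsubmx U in
  let S2 : 'M[R]_d := diag_mx (rsubmx s) in
  let Vc : 'M[R]_(n + d, (n - fourfold p) + d) := Q2 *m V in
  let V12 : 'M[R]_(n, d) := ursubmx Vc in
  let V22 : 'M[R]_d := drsubmx Vc in
  V22 \in unitmx ->
  let X0 : 'M[R]_(n, d) := - (V12 *m invmx V22) in
  [/\ real_rbtlse_solution A B C D X0,
      (forall X : 'M[R]_(n, d), real_rbtlse_solution A B C D X -> X = X0)
    & forall (E : 'M[rbq R]_(m, n)) (F : 'M[rbq R]_(m, d)),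
        rbtlse_minimizer A B C D X0 E F <->
        rb_col E = - (U2 *m S2 *m V12^T) /\ rb_col F = - (U2 *m S2 *m V22^T)].
Proof.
move=> U2 S2 Vc V12 V22 V22u X0.
pose Vc2 := rsubmx Vc; pose G0 := - (U2 *m S2 *m Vc2^T).
pose Z (X : 'M[R]_(n, d)) := col_mx X (- 1%:M).
pose P := row_mx (rb_col A) (rb_col B).
pose S := row_mx (rb_col C) (rb_col D).
have Vc2E : Vc2 = col_mx V12 V22.
  by rewrite /Vc2 -[Vc]submxK block_mxEh row_mxKr.
have G0E : G0 = row_mx (- (U2 *m S2 *m V12^T)) (- (U2 *m S2 *m V22^T)).
  by rewrite /G0 Vc2E tr_col_mx mul_mx_row opp_row_mx.
have [QQ11 QQ12 QQ21 QQ22] :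
    [/\ Q1^T *m Q1 = 1%:M, Q1^T *m Q2 = 0, Q2^T *m Q1 = 0 & Q2^T *m Q2 = 1%:M].
  move: hQ; rewrite tr_row_mx mul_col_row (scalar_mx_block _ _ 1).
  by case/eq_block_mx.
have QQ' : Q1 *m Q1^T + Q2 *m Q2^T = 1%:M by rewrite -mul_row_col -tr_row_mx.
have SE : S = Rh^T *m Q1^T.
  by rewrite -[S]trmxK hQR mul_row_col mulmx0 addr0 trmx_mul.
(* A right inverse of [rb_col C], padded with zero rows, is one of [S = Rh^T *m Q1^T], which inverts
   the square factor [Rh^T]. *)
have Rhu : Rh^T \in unitmx.
  have [J CJ] := row_freeP hC.
  have : Rh^T *m (Q1^T *m col_mx J 0) = 1%:M.
    by rewrite mulmxA -SE mul_row_col mulmx0 addr0.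
  by case/mulmx1_unit.
have SZ (X : 'M[R]_(n, d)) : S *m Z X = 0 <-> Q1^T *m Z X = 0.
  by rewrite SE -mulmxA; split=> [/(canRL (mulKmx Rhu)) ->|->]; rewrite mulmx0.
(* The block [-I] alone gives [Z X] full column rank, with a left inverse independent of [X]. *)
have LZ X : row_mx 0 (- 1%:M) *m Z X = 1%:M.
  by rewrite mul_row_col mul0mx add0r mulmxN mulmx1 opprK.
have Z0 : Z X0 = Vc2 *m - invmx V22.
  by rewrite Vc2E mul_col_mx !mulmxN mulmxV.
have [tau hl hr] : exists2 tau,
    (forall i, tau < s 0 (lshift d i) ^+ 2) &
    (forall j, s 0 (rshift (n - fourfold p) j) ^+ 2 <= tau).
  exact: separating_square hs_pos hs_anti hs_gap.
have VcVc : Vc2^T *m Vc2 = 1%:M.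
  apply: rsubmx_isom; rewrite /Vc trmx_mul mulmxA -(mulmxA _ _ Q2) QQ22.
  by rewrite mulmx1.
have U2U2 : U2^T *m U2 = 1%:M by apply: rsubmx_isom.
(* The trailing right singular vectors select the trailing block of the SVD; with [VcVc], this makes
   [P + G0] kill [Vc2]. *)
have PVc2 : P *m Vc2 = U2 *m S2.
  rewrite /Vc2 mulmx_rsub mulmxA hSVD -(mulmxA _ V^T) -mulmx_rsub hV.
  rewrite scalar_mx_block block_mxEh row_mxKr mulmx_split_diag col_mxKu col_mxKd.
  by rewrite mulmx0 add0r mulmx1.
have sqG0 : sqf G0 = sqf S2.
  by rewrite sqf_opp sqf_mul_isom ?trmxK // sqf_isom_mul.
have lower X E F : rbtlse_feasible A B C D X E F ->
    sqf S2 <= sqf (rb_col (row_mx E F)) /\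
    (sqf (rb_col (row_mx E F)) = sqf S2 -> X = X0 /\ rb_col (row_mx E F) = G0).
  move=> /rbtlse_feasibleE[hP /SZ hS].
  have [h1 h2] := min_constrained_perturbation QQ22 QQ' hSVD hU hV hl hr
    (LZ X) hS hP.
  split=> // /h2[[K ZK] ->]; split=> //.
  (* The lower block of [Z X = Vc2 *m K] reads [-I = V22 *m K], which determines [K] and then
     [X]. *)
  move: ZK; rewrite -/Vc -/Vc2 Vc2E mul_col_mx => /eq_col_mx[-> hK].
  by rewrite -[K](mulKmx V22u) -hK mulmxN mulmx1 mulmxN.
have feas E F : rb_col (row_mx E F) = G0 -> rbtlse_feasible A B C D X0 E F.
  move=> GE; apply/rbtlse_feasibleE; rewrite GE -/P -/S; split; last first.
    apply/SZ; rewrite Z0 /Vc2 /Vc -mulmx_rsub !mulmxA.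
    by rewrite QQ12 !mul0mx.
  rewrite -/(Z X0) Z0 mulmxA mulmxDl PVc2 mulNmx -(mulmxA _ Vc2^T) VcVc mulmx1.
  by rewrite subrr mul0mx.
(* A minimizer costs no more than the lift of [G0], which attains the lower bound, so the equality
   case of [lower] applies. *)
have minE X E F : rbtlse_minimizer A B C D X E F <->
    X = X0 /\ rb_col (row_mx E F) = G0.
  split=> [[hf hmin]|[-> GE]]; last first.
    split=> [|X' E' F' /lower[h _]]; first exact: feas.
    by rewrite !rb_frobE ler_sqrt ?sqf_ge0 // GE sqG0.
  have [h1] := lower _ _ _ hf; apply; apply: le_anti; rewrite h1 andbT.
  have [E0 E0E] := rb_col_surj (lsubmx G0).
  have [F0 F0E] := rb_col_surj (rsubmx G0).
  have GE : rb_col (row_mx E0 F0) = G0 by rewrite rb_col_row_mx E0E F0E hsubmxK.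
  by have := hmin _ _ _ (feas _ _ GE); rewrite !rb_frobE ler_sqrt ?sqf_ge0 // GE sqG0.
split=> [|X [E [F /minE[]]] //|E F].
  have [E0 E0E] := rb_col_surj (lsubmx G0).
  have [F0 F0E] := rb_col_surj (rsubmx G0).
  by exists E0, F0; apply/minE; rewrite rb_col_row_mx E0E F0E hsubmxK.
split=> [/minE[_]|[hE hF]].
  by rewrite rb_col_row_mx G0E => /eq_row_mx.
by apply/minE; rewrite rb_col_row_mx hE hF G0E.
Qed.
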